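(* Let $G$ be a separable topological group, let $X$ be a separable compact Hausdorff space, and let $\theta$ be a continuous partial action of $G$ on $X$ such that $G*X$ is open in $G\times X$. Let $\mathcal{H}\in\{\mathcal{H}_1,\mathcal{H}_3\}$. Then: (i) $X_G$ is separable. (ii) $\mathcal{H}_G$ is separable, where $\mathcal{H}=\mathcal{H}(X)$ carries the induced partial action $2^\theta$. (iii) If $X_G$ is $T_1$, then $\mathcal{H}(X_G)$ and $\mathcal{H}(F(X)_G)$ are separable.
   Context: Partial actions. A (set-theoretic) partial action of a group $G$ on a set $X$ is a partially defined function $\theta:G\times X\dashrightarrow X$, $(g,x)\mapsto g\cdot x$ (write $\exists g\cdot x$ if $g\cdot x$ is defined), such that for all $g,h\in G$, $x\in X$: (PA1) if $\exists g\cdot x$ then $\exists g^{-1}\cdot(g\cdot x)$ and $g^{-1}\cdot(g\cdot x)=x$; (PA2) if $\exists g\cdot(h\cdot x)$ then $\exists (gh)\cdot x$ and $g\cdot(h\cdot x)=(gh)\cdot x$; (PA3) $\exists 1\cdot x$ and $1\cdot x=x$. Put $G*X=\{(g,x)\in G\times X:\exists g\cdot x\}$ (the domain of $\theta$) and $X_g=\{x\in X:\exists g^{-1}\cdot x\}$; then $\theta$ is determined by the bijections $\theta_g:X_{g^{-1}}\to X_g$, $x\mapsto g\cdot x$, and one writes $\theta=(\theta_g,X_g)_{g\in G}$. For $G$ a topological group and $X$ a topological space, $G*X$ has the subspace topology of the product $G\times X$; $\theta$ is a topological partial action if every $X_g$ is open in $X$ and every $\theta_g$ is a homeomorphism; such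 a $\theta$ is continuous if moreover $\theta:G*X\to X$ is continuous. Enveloping space. For a topological partial action $\theta$ of $G$ on $X$, define the equivalence relation $R$ on $G\times X$ by $(g,x)R(h,y)$ iff $x\in X_{g^{-1}h}$ and $\theta_{h^{-1}g}(x)=y$. The enveloping space is $X_G=(G\times X)/R$ with the quotient topology. The enveloping space of a partial action on a hyperspace is defined in the same way. Hyperspaces. For a topological space $Y$, $\mathcal{H}_1(Y)=2^Y$ is the set of non-empty compact subsets of $Y$, with the Vietoris topology, generated by the sets $\langle U_1,\dots,U_n\rangle=\{A\in\mathcal{H}_1(Y): A\subseteq\bigcup_{i=1}^nU_i,\ A\cap U_i\ne\emptyset\ (1\le i\le n)\}$ for non-empty open $U_1,\dots,U_n\subseteq Y$ (and $\langle\emptyset\rangle:=\emptyset$); $\mathcal{H}_3(Y)=F(Y)$ is the subspace of non-empty finite subsets of $Y$. $\mathcal{H}_i$ without argument means $\mathcal{H}_i(X)$; $\mathcal{H}(Y)$ denotes $\mathcal{H}_1(Y)$ or $\mathcal{H}_3(Y)$ according to the choice of $\mathcal{H}$. $\langle U\rangle_{\mathcal{H}}=\{A\in\mathcal{H}:A\subseteq U\}$. Induced partial action. $2^{\theta}=(2^{\theta_g},\langle X_g\rangle_{\mathcal{H}})_{g\in G}$ with $2^{\theta_g}:\langle X_{g^{-1}}\rangle_{\mathcal{H}}\to\langle X_g\rangle_{\mathcal{H}}$, $A\mapsto\theta_g(A)$, is a topological partial action of $G$ on $\mathcal{H}$; $\mathcal{H}_G$ is its enveloping space. $F(X)_G=(\mathcal{H}_3)_G$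 is the enveloping space of the induced partial action on $F(X)=\mathcal{H}_3$. *)

(* Defs.v *)
From HB Require Import structures.
From mathcomp Require Import all_boot all_classical topology.

Set Implicit Arguments.
Unset Strict Implicit.
Unset Printing Implicit Defensive.

Local Open Scope classical_set_scope.
Local Open Scope group_scope.
Local Open Scope quotient_scope.

HB.mixin Record Group_isTopologicalGroup G & Topological G & Group G := {
  mulg_continuous : continuous (fun p : G * G => p.1 * p.2) ;
  invg_continuous : continuous (fun g : G => g^-1)
}.

#[short(type="topologicalGroupType")]
HB.structure Definition TopologicalGroup :=
  {G of Topological G & Group G & Group_isTopologicalGroup G}.

Definition separable (T : topologicalType) :=
  exists2 D : set T, countable D & dense D.

Definition homeomorphism (S T : topologicalType) (f : S -> T) :=
  continuous f /\
  exists2 f' : T -> S, cancel f f' /\ cancel f' f & continuous f'.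

Definition oval U (o : option U) : o -> U :=
  match o return o -> U with
  | Some u => fun=> u
  | None => fun h => False_rect U (notF h)
  end.

Lemma ovalP U (o : option U) (h : o) : o = Some (oval h).
Proof. by case: o h. Qed.

(* The partially defined g . x is encoded in option X: it is defined, with
   value y, iff pact g x = Some y; isSome coerces option X to bool. *)
Record partial_action (G : groupType) (X : Type) := PartialAction {
  pact :> G -> X -> option X ;
  pactV : forall g x y, pact g x = Some y -> pact g^-1 y = Some x ;
  pactM : forall g h x y z,
    pact h x = Some y -> pact g y = Some z -> pact (g * h) x = Some z ;
  pact1 : forall x, pact 1 x = Some x
}.

Section PartialActionSets.
Context (G : groupType) (X : Type) (theta : partial_action G X).

(* The domain G * X of theta. *)
Definition pact_graph : set (G * X) := [set p | theta p.1 p.2].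

Definition pact_fun (p : pact_graph) : X := oval (set_mem (valP p)).

(* X_g = {x | g^-1 . x is defined}, so that X_{g^-1} is the domain of theta_g. *)
Definition pact_dom (g : G) : set X := [set x | theta g^-1 x].

Lemma pact_domV g x : pact_dom g^-1 x = theta g x :> Prop.
Proof. by rewrite /pact_dom /= invgK. Qed.

Lemma pact_domV_def g (x : pact_dom g^-1) : theta g (val x).
Proof. by rewrite -pact_domV; exact: set_mem (valP x). Qed.

Lemma pact_trans_subproof g (x : pact_dom g^-1) :
  oval (pact_domV_def x) \in pact_dom g.
Proof. by apply: mem_set; rewrite /pact_dom /= (pactV (ovalP _)). Qed.

Definition pact_trans g (x : pact_dom g^-1) : pact_dom g :=
  SigSub (pact_trans_subproof x).

Definition env_rel (p q : G * X) : bool :=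
  `[< pact_dom (p.1^-1 * q.1) p.2 /\ theta (q.1^-1 * p.1) p.2 = Some q.2 >].

Lemma env_relP p q : reflect (theta (q.1^-1 * p.1) p.2 = Some q.2) (env_rel p q).
Proof.
apply: (iffP (asboolP _)) => [[]//|e]; split=> //.
by rewrite /pact_dom /= invgM invgK e.
Qed.

Lemma env_rel_equiv : equiv_class_of env_rel.
Proof.
split=> [p|p q|q p r].
- by apply/env_relP; rewrite mulVg pact1.
- apply/idP/idP => /env_relP e; apply/env_relP;
    by have := pactV e; rewrite invgM invgK.
- move=> /env_relP pq /env_relP qr; apply/env_relP.
  by have := pactM pq qr; rewrite mulgA mulgK.
Qed.

Canonical env_equiv : equiv_rel (G * X)%type := EquivRelPack env_rel_equiv.

End PartialActionSets.

Definition topological_paction (G : topologicalGroupType) (X : topologicalType)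
    (theta : partial_action G X) :=
  forall g, open (pact_dom theta g) /\ homeomorphism (@pact_trans _ _ theta g).

Definition enveloping (G : topologicalGroupType) (X : topologicalType)
    (theta : partial_action G X) : topologicalType :=
  quotient_topology {eq_quot (env_equiv theta)}.

Definition compacts (Y : topologicalType) : Type :=
  set_type [set A : set Y | A !=set0 /\ compact A].

Section Vietoris.
Context (Y : topologicalType).

HB.instance Definition _ := Choice.on (compacts Y).

Definition compacts_set (A : compacts Y) : set Y := \val A.

Definition vietoris_box n (U : 'I_n -> set Y) : set (compacts Y) :=
  [set A | compacts_set A `<=` \bigcup_i U i /\
           forall i, compacts_set A `&` U i !=set0].

(* The open sets U_0, .., U_n are at least one and all non-empty. *)
Definition vietoris_subbase : set (set (compacts Y)) :=
  [set W | exists n (U : 'I_n.+1 -> set Y),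
     (forall i, open (U i) /\ U i !=set0) /\ W = vietoris_box U].

HB.instance Definition _ :=
  isSubBaseTopological.Build (compacts Y) vietoris_subbase id.

Definition finites : set (compacts Y) := [set A | finite_set (compacts_set A)].

End Vietoris.

Arguments finites Y : clear implicits.

(* H1: non-empty compact sets, with the Vietoris topology;
   H3: non-empty finite sets, as a subspace of the former. *)
Variant hyper_kind := H1 | H3.

Definition hyper (k : hyper_kind) (Y : topologicalType) : topologicalType :=
  match k with
  | H1 => compacts Y
  | H3 => set_type (finites Y)
  end.

Definition hset k Y : hyper k Y -> set Y :=
  match k return hyper k Y -> set Y with
  | H1 => @compacts_set Y
  | H3 => fun A => compacts_set (\val A)
  end.

Definition hyper_pred k (Y : topologicalType) (A : set Y) : Prop :=
  A !=set0 /\ match k with H1 => compact A | H3 => finite_set A end.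

Lemma hset_pred k Y (A : hyper k Y) : hyper_pred k (hset A).
Proof.
case: k A => A; first exact: set_mem (valP A).
by split; [case: (set_mem (valP (\val A))) | exact: set_mem (valP A)].
Qed.

Lemma hset_compact k Y (A : hyper k Y) : compact (hset A).
Proof.
by case: k A => [A|A]; [case: (hset_pred (k:=H1) A)
                       |case: (set_mem (valP (\val A)))].
Qed.

Lemma hset_inj k Y : injective (@hset k Y).
Proof. by case: k => A B /= AB; apply/val_inj => //; exact/val_inj. Qed.

Definition mk_compacts (Y : topologicalType) (A : set Y)
    (hA : A !=set0 /\ compact A) : compacts Y := SigSub (mem_set hA).

Lemma finites_subproof (Y : topologicalType) (A : set Y) :
  A !=set0 /\ finite_set A -> A !=set0 /\ compact A.
Proof. by case=> A0 fA; split=> //; exact: finite_compact. Qed.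

Definition mk_finites (Y : topologicalType) (A : set Y)
    (hA : A !=set0 /\ finite_set A) : finites Y :=
  SigSub (mem_set (hA.2 : finites Y (mk_compacts (finites_subproof hA)))).

Definition mk_hyper k (Y : topologicalType) (A : set Y) :
    hyper_pred k A -> hyper k Y :=
  match k return hyper_pred k A -> hyper k Y with
  | H1 => @mk_compacts Y A
  | H3 => @mk_finites Y A
  end.

Lemma mk_hyperK k (Y : topologicalType) (A : set Y) (hA : hyper_pred k A) :
  hset (mk_hyper hA) = A.
Proof. by case: k hA. Qed.

Section InducedAction.
Context (G : topologicalGroupType) (X : topologicalType).
Context (theta : partial_action G X) (htheta : topological_paction theta).
Context (k : hyper_kind).

Definition pact_image g (A : set X) : set X :=
  [set y | exists2 x, A x & theta g x = Some y].

Lemma pact_image_hyper g (A : hyper k X) :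
  hset A `<=` pact_dom theta g^-1 -> hyper_pred k (pact_image g (hset A)).
Proof.
move=> sA; have [[x0 Ax0] kA] := hset_pred A; pose f x := odflt x0 (theta g x).
have fE x : hset A x -> theta g x = Some (f x).
  by move=> /sA; rewrite pact_domV /f; case: (theta g x).
have imE : pact_image g (hset A) = f @` hset A.
  apply/seteqP; split=> y [x Ax].
    by rewrite fE// => -[<-]; exists x.
  by move=> <-; exists x => //; exact: fE.
have cf : {within hset A, continuous f}.
  apply: (continuous_subspaceW sA); apply/subspace_sigL_continuousP.
  suff -> : sigL (pact_dom theta g^-1) f = \val \o @pact_trans _ _ theta g.
    move=> x; apply: continuous_comp; first exact: (htheta g).2.1.
    exact: initial_continuous.
  apply/funext => x; rewrite /sigL /=; apply/Some_inj.
  by rewrite -ovalP /f; case: (theta g _) (pact_domV_def x).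
have cA : compact (hset A) by exact: hset_compact.
rewrite /hyper_pred imE; split; first by exists (f x0), x0.
move: (hset A) cf cA kA => S cf cA; case: k => [_|]; last exact: finite_image.
exact: continuous_compact.
Qed.

Definition hyper_pact_fun g (A : hyper k X) : option (hyper k X) :=
  match pselect (hset A `<=` pact_dom theta g^-1) with
  | left sA => Some (mk_hyper (pact_image_hyper sA))
  | right _ => None
  end.

Lemma hyper_pact_funP g A B : hyper_pact_fun g A = Some B <->
  hset A `<=` pact_dom theta g^-1 /\ hset B = pact_image g (hset A).
Proof.
rewrite /hyper_pact_fun; case: pselect => [sA|nsA]; last by split=> // -[].
split=> [[<-]|[_ BE]]; first by rewrite mk_hyperK.
by congr Some; apply: hset_inj; rewrite mk_hyperK.
Qed.

Lemma hyper_pactV g A B :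
  hyper_pact_fun g A = Some B -> hyper_pact_fun g^-1 B = Some A.
Proof.
move=> /hyper_pact_funP[sA BE]; apply/hyper_pact_funP; rewrite BE; split.
  by move=> y [x Ax e]; rewrite pact_domV (pactV e).
apply/seteqP; split=> [x Ax|x [y [z Az e]]]; last by rewrite (pactV e) => -[<-].
have := sA _ Ax; rewrite pact_domV; case e : (theta g x) => [y|//] _.
by exists y; [exists x | exact: pactV].
Qed.

Lemma hyper_pactM g h A B C :
  hyper_pact_fun h A = Some B -> hyper_pact_fun g B = Some C ->
  hyper_pact_fun (g * h) A = Some C.
Proof.
move=> /hyper_pact_funP[sA BE] /hyper_pact_funP[sB CE].
have key x : hset A x ->
    exists y z, [/\ theta h x = Some y, theta g y = Some z & hset B y].
  move=> Ax; have := sA _ Ax; rewrite pact_domV.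
  case e : (theta h x) => [y|//] _; have By : hset B y by rewrite BE; exists x.
  have := sB _ By; rewrite pact_domV; case e' : (theta g y) => [z|//] _.
  by exists y, z.
apply/hyper_pact_funP; split.
  move=> x /key[y [z [e e' _]]].
  by rewrite pact_domV (pactM e e').
rewrite CE; apply/seteqP; split=> [z [y]|z [x Ax]].
  by rewrite BE => -[x Ax e] e'; exists x => //; exact: pactM e e'.
have [y [z' [e e' By]]] := key _ Ax.
by rewrite (pactM e e') => -[<-]; exists y.
Qed.

Lemma hyper_pact1 A : hyper_pact_fun 1 A = Some A.
Proof.
apply/hyper_pact_funP; split=> [x _|]; first by rewrite pact_domV pact1.
apply/seteqP; split=> [x Ax|x [y Ay]]; first by exists x => //; exact: pact1.
by rewrite pact1 => -[<-].
Qed.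

Definition hyper_pact : partial_action G (hyper k X) :=
  PartialAction hyper_pactV hyper_pactM hyper_pact1.

End InducedAction.

(* Main.v *)
Require Import Defs.
From mathcomp Require Import all_boot all_classical topology.

(** Separability passes to finite products and to continuous images, hence to
    every enveloping space, which is a quotient of G * X. It also passes from a
    space Y to its hyperspaces: if D is a countable dense subset of Y, the
    non-empty finite subsets of D are countably many, and they are dense for
    the Vietoris topology. Indeed, around a compact set A, a Vietoris open set
    asks of its members only that they lie in some open V containing A and meet
    finitely many open sets U that A meets ([open_vietoris]); each
    intersection of V with U is a non-empty open set, so a point of D can be
    picked in it, and the points so picked form the required finite set
    ([separable_hyper]). Being finite, this set belongs to F(Y) as well as to
    2^Y, so both hyperspaces are treated at once.

    The three claims combine these two facts; for instance the hyperspaces of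
    F(X)_G are reached from X by passing to F(X), then to its enveloping
    space, then to the hyperspace of the latter. *)

Set Implicit Arguments.
Unset Strict Implicit.
Unset Printing Implicit Defensive.

Local Open Scope classical_set_scope.
Local Open Scope quotient_scope.

Lemma separable_continuous_surj (S T : topologicalType) (f : S -> T) :
  continuous f -> (forall y, exists x, f x = y) -> separable S -> separable T.
Proof.
move=> cf sf [D cD dD]; exists (f @` D); first exact: sub_countable (card_image_le _ _) cD.
move=> O [y Oy] oO; have [x xy] := sf y.
have [z [Oz Dz]] : (f @^-1` O) `&` D !=set0.
  by apply: dD; [exists x; rewrite /= xy | move/continuousP: cf; exact].
by exists (f z); split=> //; exists z.
Qed.

Lemma separable_prod (S T : topologicalType) :
  separable S -> separable T -> separable (S * T)%type.
Proof.
move=> [D cD dD] [E cE dE]; exists (D `*` E); first exact: countableX.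
move=> O [p Op] oO; have [[U V] /= [nU nV] UVO] := open_nbhs_nbhs (conj oO Op).
have [x [Ux Dx]] : U^° `&` D !=set0.
  by apply: dD; [exists p.1 | exact: open_interior].
have [y [Vy Ey]] : V^° `&` E !=set0.
  by apply: dE; [exists p.2 | exact: open_interior].
by exists (x, y); split=> //; apply: UVO; split; exact: interior_subset.
Qed.

Lemma separable_enveloping (G : topologicalGroupType) (X : topologicalType)
    (theta : partial_action G X) :
  separable G -> separable X -> separable (enveloping theta).
Proof.
move=> sG sX; apply: separable_continuous_surj (separable_prod sG sX).
  exact: (@pi_continuous _ {eq_quot (env_equiv theta)}).
by move=> q; exists (repr q); exact: reprK.
Qed.

(** A neighbourhood condition that, unlike being a Vietoris box, is visibly
    stable under finite intersections. *)
Definition vietoris_filter (Y : topologicalType) (A : set Y)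
    : set_system (compacts Y) :=
  [set W | exists V (Us : set (set Y)),
     [/\ open V /\ A `<=` V,
         finite_set Us,
         forall U, Us U -> open U /\ A `&` U !=set0 &
         forall B : compacts Y, compacts_set B `<=` V ->
           (forall U, Us U -> compacts_set B `&` U !=set0) -> W B]].

Lemma vietoris_filter_filter (Y : topologicalType) (A : set Y) :
  Filter (vietoris_filter A).
Proof.
split.
- exists setT, set0; split=> //; split=> //; exact: openT.
- move=> W W' [V [Us [[oV AV] fUs hUs sW]]] [V' [Us' [[oV' AV'] fUs' hUs' sW']]].
  exists (V `&` V'), (Us `|` Us'); split.
  + by split; [exact: openI | rewrite subsetI].
  + by rewrite finite_setU.
  + by move=> U [/hUs|/hUs'].
  + move=> B; rewrite subsetI => -[BV BV'] hB.
    by split; [apply: sW | apply: sW'] => // U UsU; apply: hB; [left | right].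
- move=> W W' WW' [V [Us [hV fUs hUs sW]]]; exists V, Us; split=> // B BV hB.
  exact/WW'/sW.
Qed.

Lemma open_vietoris (Y : topologicalType) (W : set (compacts Y))
    (A : compacts Y) :
  open W -> W A -> vietoris_filter (compacts_set A) W.
Proof.
have FA := @vietoris_filter_filter _ (compacts_set A).
move=> [Ws sWs <-] [W0 Ws0 W0A]; apply: (@filterS _ _ FA W0).
  by move=> B W0B; exists W0.
have [E sE EW0] := sWs _ Ws0; rewrite -EW0 in W0A *.
apply: filter_bigI => S SE.
have [n [U [hU SU]]] := set_mem (sE _ SE).
have : S A by exact: W0A.
rewrite SU => -[AU AUi]; exists (\bigcup_i U i), (range U); split.
- by split=> //; apply: bigcup_open => i _; exact: (hU i).1.
- exact/finite_image/finite_finset.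
- by move=> _ [i _ <-]; split; [exact: (hU i).1 | exact: AUi].
- by move=> B BU BUi; split=> // i; apply: BUi; exists i.
Qed.

(** One point of D is picked in the intersection of V with each member of Us,
    and one more in V itself, since Us may be empty and B may not. *)
Lemma vietoris_filter_finite (Y : topologicalType) (D A : set Y)
    (W : set (compacts Y)) :
  dense D -> A !=set0 -> vietoris_filter A W ->
  exists2 B : set Y, B !=set0 /\ (B `<=` D /\ finite_set B) &
    forall C : compacts Y, compacts_set C = B -> W C.
Proof.
move=> dD [a Aa] [V [Us [[oV AV] fUs hUs sW]]].
have [d0 [Vd0 Dd0]] : V `&` D !=set0 by apply: dD => //; exists a; exact: AV.
have /choice[d hd] (U : set Y) : exists x, Us U -> [/\ V x, U x & D x].
  have [UsU|nUsU] := pselect (Us U); last by exists d0.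
  have [oU [x [Ax Ux]]] := hUs _ UsU.
  have [y [[Vy Uy] Dy]] : (V `&` U) `&` D !=set0.
    by apply: dD; [exists x; split=> //; exact: AV | exact: openI].
  by exists y.
exists ([set d0] `|` d @` Us).
  split; first by exists d0; left.
  split; first by move=> y [->//|[U /hd[_ _ Dy] <-]].
  by rewrite finite_setU; split; [exact: finite_set1 | exact: finite_image].
move=> C CE; apply: sW; rewrite CE; first by move=> y [->//|[U /hd[Vy _ _] <-]].
move=> U UsU; have [_ Uy _] := hd _ UsU.
by exists (d U); split=> //; right; exists U.
Qed.

Lemma separable_hyper k (Y : topologicalType) :
  separable Y -> separable (hyper k Y).
Proof.
move=> [D cD dD].
exists [set A : hyper k Y | hset A `<=` D /\ finite_set (hset A)].
  have /countable_injP[f injf] := countable_finite_subset cD.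
  apply/countable_injP; exists (f \o @hset k Y) => A B /set_mem hA /set_mem hB e.
  by apply: hset_inj; apply: injf e; exact: mem_set.
case: k => [O [A OA] oO|O [A OA] [W oW WO]].
  have [A0 _] := hset_pred A.
  have [B [B0 [BD fB]] OB] :=
    vietoris_filter_finite dD A0 (open_vietoris oO OA).
  exists (mk_compacts (finites_subproof (conj B0 fB))).
  by split; [exact: OB|].
rewrite -WO in OA *; have [A0 _] := hset_pred A.
have [B [B0 [BD fB]] WB] := vietoris_filter_finite dD A0 (open_vietoris oW OA).
by exists (mk_finites (conj B0 fB)); split; [exact: WB|].
Qed.

Theorem corollary3p12 (G : topologicalGroupType) (X : topologicalType)
    (theta : partial_action G X) (htheta : topological_paction theta)
    (k : hyper_kind) :
  separable G ->
  separable X -> compact [set: X] -> hausdorff_space X ->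
  continuous (@pact_fun _ _ theta) ->
  open (pact_graph theta) ->
  [/\ separable (enveloping theta),
      separable (enveloping (hyper_pact htheta k)) &
      accessible_space (enveloping theta) ->
        separable (hyper k (enveloping theta)) /\
        separable (hyper k (enveloping (hyper_pact htheta H3)))].
Proof.
move=> sG sX _ _ _ _; split=> [||_]; last split.
- exact: separable_enveloping.
- exact/separable_enveloping/separable_hyper.
- exact/separable_hyper/separable_enveloping.
- exact/separable_hyper/separable_enveloping/separable_hyper.
Qed.
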